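(* Let $n\in\mathbb N$ and assume that the $2dq\times2dq$ matrix $$\mathcal B_n=\begin{bmatrix} B_n^{(1)}(z_{1,1})&\cdots&B_n^{(1)}(z_{1,2d})&\cdots&B_n^{(q)}(z_{q,1})&\cdots&B_n^{(q)}(z_{q,2d})\\ \vdots&&\vdots&&\vdots&&\vdots\\ B_{n+2dq-1}^{(1)}(z_{1,1})&\cdots&B_{n+2dq-1}^{(1)}(z_{1,2d})&\cdots&B_{n+2dq-1}^{(q)}(z_{q,1})&\cdots&B_{n+2dq-1}^{(q)}(z_{q,2d}) \end{bmatrix}$$ is invertible. Then for every $a\in\{1,\dots,p\}$ and nonzero $x$, $$\hat A^{(a)}_{n-1}(x^{-1})=\frac{-1}{\tilde N_{C,n-1}}\;\kappa_a^{[n]}(x)\,\mathcal B_n^{-1}\,\boldsymbol e_{2dq},$$ where $\boldsymbol e_{2dq}=(0,\dots,0,1)^\top\in\mathbb C^{2dq}$, $\tilde N_{C,n-1}=(N_C)_{n-1,n-1+2dq}$, and $\kappa_a^{[n]}(x)$ is the row vector $$\kappa_a^{[n]}(x)=\big(K_{a,1}^{[n]}(x,z_{1,1}),\dots,K_{a,1}^{[n]}(x,z_{1,2d}),\dots,K_{a,q}^{[n]}(x,z_{q,1}),\dots,K_{a,q}^{[n]}(x,z_{q,2d})\big).$$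
   Context: Let $p,q,d\in\mathbb N$ and let $\mu$ be a $q\times p$ matrix of complex Borel measures with infinite support on the unit circle $\mathbb T=\{|z|=1\}$. Rows and columns of semi-infinite matrices are indexed from $0$. For $r\in\mathbb N$, $Z_{[r]}(z)$ is the $\infty\times r$ matrix obtained by stacking the $r\times r$ blocks $I_r, z^{-1}I_r, zI_r, z^{-2}I_r, z^2I_r,\dots$ (block number $2N$ is $z^NI_r$, block number $2N+1$ is $z^{-N-1}I_r$). Let $W_{[q]}(z)=\mathrm{diag}(W_1(z),\dots,W_q(z))$, where each $W_b$ is a balanced Laurent polynomial $W_b(z)=c_bz^{-d}\prod_{\ell=1}^{2d}(z-z_{b,\ell})$, $c_b\neq0$, with $2d$ distinct nonzero zeros, the $2dq$ zeros $z_{b,\ell}$ being all different. The Christoffel perturbed matrix of measures is $\mathrm d\hat\mu(z)=W_{[q]}(z)\,\mathrm d\mu(z)$. The moment matrices are $M=\oint_{\mathbb T}Z_{[q]}(z)\,\mathrm d\mu(z)\,Z_{[p]}^\top(z^{-1})$ and $\hat M=\oint_{\mathbb T}Z_{[q]}(z)\,\mathrm d\hat\mu(z)\,Z_{[p]}^\top(z^{-1})$. It is assumed that both have Gauss--Borel factorizations $M=L^{-1}U^{-1}$, $\hat M=\hat L^{-1}\hat U^{-1}$, with $L,\hat L$ lower triangular and $U,\hat U$ upper triangular semi-infinite matrices with nonzero diagonal entries. Put $B(z)=LZ_{[q]}(z)$ (entries $B_n^{(b)}(z)$, row $n$, column $b$), $A(z^{-1})=Z_{[p]}^\top(z^{-1})U$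 (entries $A_n^{(a)}(z^{-1})$, row $a$, column $n$), $\hat A(z^{-1})=Z_{[p]}^\top(z^{-1})\hat U$ (entries $\hat A_n^{(a)}(z^{-1})$). The Christoffel--Darboux kernel has entries $K_{a,b}^{[n]}(x,y)=\sum_{k=0}^{n-1}A_k^{(a)}(x^{-1})B_k^{(b)}(y)$. The connection matrix is $N_C=\hat U^{-1}U$; it is upper triangular and banded with $2dq$ superdiagonals (entries $(N_C)_{i,j}$ vanish unless $i\le j\le i+2dq$). *)

(* Defs.v *)
From HB Require Import structures.
From mathcomp Require Import all_boot all_order all_algebra.
From mathcomp Require Import complex.
From mathcomp Require Import all_classical all_reals all_analysis.

Set Implicit Arguments.
Unset Strict Implicit.
Unset Printing Implicit Defensive.

Import Order.TTheory GRing.Theory Num.Theory.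
Import numFieldNormedType.Exports.

Local Open Scope classical_set_scope.
Local Open Scope ring_scope.
Local Open Scope complex_scope.

Definition circle (R : realType) := {z : R[i] | `|z| == 1}.

Section circle_borel.
Variable R : realType.

Let norm1 : `|1 : R[i]| == 1. Proof. by rewrite normr1. Qed.

HB.instance Definition _ := Choice.on (circle R).
HB.instance Definition _ :=
  isPointed.Build (circle R) (exist _ (1 : R[i]) norm1).

(* subspace topology inherited from the complex plane; the regular algebra
   R[i]^o is what carries the topology of the normed field R[i] *)
Definition circle_open : set (set (circle R)) :=
  [set V | exists2 U : set (R[i]^o), open U & V = val @^-1` U].

Definition circle_borel := g_sigma_algebraType circle_open.

End circle_borel.

Section complex_measure.
Variable R : realType.
Local Notation T := (circle_borel R).

(* A complex Borel measure on the unit circle is Re mu + i Im mu with Re mu and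
   Im mu finite signed measures; library charges are finite-valued. *)
Record cmeasure := CMeasure {
  cm_re : {charge set T -> \bar R} ;
  cm_im : {charge set T -> \bar R} }.

Definition cmeasure_val (mu : cmeasure) (E : set T) : R[i] :=
  fine (cm_re mu E) +i* fine (cm_im mu E).
Coercion cmeasure_val : cmeasure >-> Funclass.

(* The complement of the support is the largest open set all of whose
   measurable subsets have measure 0. *)
Definition cm_support (mu : cmeasure) : set (circle R) :=
  [set z | forall V, circle_open V -> V z ->
     exists E : set T, [/\ measurable E, E `<=` V & mu E != 0]].

Section charge_integral.
Variable nu : {charge set T -> \bar R}.

Let hahnP := cid (Hahn_decomposition nu).
Let hahnN := cid (svalP hahnP).

(* Jordan decomposition: the integral against nu^+ minus that against nu^- *)
Definition charge_integral (E : set T) (f : T -> R) : R :=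
  Rintegral (jordan_pos (svalP hahnN)) E f
  - Rintegral (jordan_neg (svalP hahnN)) E f.

End charge_integral.

Definition cm_integral (mu : cmeasure) (E : set T) (f : R[i] -> R[i]) : R[i] :=
  let u (z : T) := complex.Re (f (val z)) in
  let v (z : T) := complex.Im (f (val z)) in
  (charge_integral (cm_re mu) E u - charge_integral (cm_im mu) E v)
  +i* (charge_integral (cm_im mu) E u + charge_integral (cm_re mu) E v).

(* d nu = w d mu *)
Definition has_density (nu mu : cmeasure) (w : R[i] -> R[i]) :=
  forall E : set T, measurable E -> nu E = cm_integral mu E w.

End complex_measure.

Section semi_infinite.
Variable R : realType.
Local Notation C := R[i].

Definition smatrix := nat -> nat -> C.

(* Entrywise finite-support sums. Every product formed below has at most
   finitely many nonzero terms in each entry, thanks to triangularity. *)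
Definition smul (I J : Type) (A : I -> nat -> C) (B : nat -> J -> C)
    (i : I) (j : J) : C :=
  \sum_(k \in [set: nat]) A i k * B k j.

Definition sid : smatrix := fun i j => (i == j)%:R.

(* A triangular semi-infinite matrix with nonzero diagonal has exactly one
   two-sided inverse, and that inverse is triangular of the same kind. *)
Definition sinv (A : smatrix) : smatrix :=
  xget (fun _ _ => 0) [set X | smul A X = sid /\ smul X A = sid].

Definition slower (A : smatrix) := forall i j, (i < j)%N -> A i j = 0.
Definition supper (A : smatrix) := forall i j, (j < i)%N -> A i j = 0.

Definition gauss_borel (M L U : smatrix) :=
  [/\ slower L, supper U, forall i, L i i != 0, forall i, U i i != 0
    & M = smul (sinv L) (sinv U)].

(* scalar of the m-th block of Z_[r]: 1, z^-1, z, z^-2, z^2, ... *)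
Definition Zblock (z : C) (m : nat) : C :=
  if odd m then z ^- (m./2.+1) else z ^+ m./2.

Definition Zmat (r : nat) (z : C) (i : nat) (a : 'I_r) : C :=
  if (i %% r)%N == a then Zblock z (i %/ r) else 0.

Definition moment (p q : nat) (mu : 'I_q -> 'I_p -> cmeasure R) : smatrix :=
  fun i j => \sum_(b < q) \sum_(a < p)
    cm_integral (mu b a) setT (fun z => Zmat z i b * Zmat z^-1 j a).

(* Bfun L z n b is B_n^(b)(z); Afun U w a n is A_n^(a)(w), so that
   A_n^(a)(z^-1) is Afun U z^-1 a n. *)
Definition Bfun (q : nat) (L : smatrix) (z : C) : nat -> 'I_q -> C :=
  smul L (@Zmat q z).

Definition Afun (p : nat) (U : smatrix) (w : C) : 'I_p -> nat -> C :=
  smul (fun a k => @Zmat p w k a) U.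

Definition CDkernel (p q : nat) (L U : smatrix) (n : nat) (x y : C)
    (a : 'I_p) (b : 'I_q) : C :=
  \sum_(k < n) Afun U x^-1 a k * Bfun L y k b.

Definition laurentW (d q : nat) (c : 'I_q -> C) (zeros : 'I_q -> 'I_(2 * d) -> C)
    (b : 'I_q) (z : C) : C :=
  c b * z ^- d * \prod_(l < 2 * d) (z - zeros b l).

(* mxvec enumerates the pairs (b, l) lexicographically, i.e. the zeros of W_1
   first, then those of W_2, and so on. *)
Definition Bmatrix (d q : nat) (L : smatrix) (zeros : 'I_q -> 'I_(2 * d) -> C)
    (n : nat) : 'M[C]_(q * (2 * d)) :=
  \matrix_(i < q * (2 * d))
    mxvec (\matrix_(b < q, l < 2 * d) Bfun L (zeros b l) (n + i)%N b).

Definition kappa (d p q : nat) (L U : smatrix) (zeros : 'I_q -> 'I_(2 * d) -> C)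
    (n : nat) (a : 'I_p) (x : C) : 'rV[C]_(q * (2 * d)) :=
  mxvec (\matrix_(b < q, l < 2 * d) CDkernel L U n x (zeros b l) a b).

Definition elast (m : nat) : 'cV[C]_m := \col_(i < m) (i.+1 == m)%:R.

Definition connection (U Uhat : smatrix) : smatrix := smul (sinv Uhat) U.

End semi_infinite.

Arguments elast {R} m.

(* Main.v *)
Require Import Defs.
From HB Require Import structures.
From mathcomp Require Import all_boot all_order all_algebra.
From mathcomp Require Import complex.
From mathcomp Require Import all_classical all_reals all_analysis.
From mathcomp Require Import measurable_realfun ring lra zify.

Set Implicit Arguments.
Unset Strict Implicit.
Unset Printing Implicit Defensive.

Import Order.TTheory GRing.Theory Num.Theory.
Import numFieldNormedType.Exports.

Local Open Scope classical_set_scope.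
Local Open Scope ring_scope.
Local Open Scope complex_scope.

(* W_[q](z) acts on Z_[q](z) as a banded matrix W with 2dq superdiagonals, so
   the perturbed moment matrix is W M and, comparing the two factorizations,
   N = Uhat^-1 U = Lhat W L^-1. Hence A = Ahat N, N is upper triangular with
   2dq superdiagonals, the last of which does not vanish, and N B(z) =
   Lhat Z(z) W_[q](z) vanishes columnwise at the zeros. Cutting N B = 0 after
   column n - 1 expresses kappa as - v B_n, where the last entry of the row v
   is Ahat_(n-1) N_(n-1, n-1+2dq).
   The analytic input is the change of density in the integrals of Laurent
   polynomials: the two sides are bounded linear functionals of the bounded
   measurable integrand that agree on indicators. *)

(** * Integration of bounded functions against charges *)

Section charge_functional.
Variable R : realType.
Local Notation T := (circle_borel R).

(** This class is closed under sums and products, and each member is integrable against both finite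
    measures of a Jordan decomposition. *)
Definition bounded_measurable (f : T -> R) :=
  measurable_fun [set: T] f /\ exists K, forall x, `|f x| <= K.

Lemma bounded_measurable_cst r : bounded_measurable (fun=> r).
Proof. by split; [exact: measurable_cst|exists `|r|]. Qed.

Lemma bounded_measurableD f g : bounded_measurable f -> bounded_measurable g ->
  bounded_measurable (fun x => f x + g x).
Proof.
move=> [mf [K fK]] [mg [K' gK]]; split; first exact: measurable_funD.
exists (K + K') => x; exact: le_trans (ler_normD _ _) (lerD (fK x) (gK x)).
Qed.

Lemma bounded_measurableM f g : bounded_measurable f -> bounded_measurable g ->
  bounded_measurable (fun x => f x * g x).
Proof.
move=> [mf [K fK]] [mg [K' gK]]; split; first exact: measurable_funM.
by exists (K * K') => x; rewrite normrM ler_pM.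
Qed.

Lemma bounded_measurableZ r f : bounded_measurable f ->
  bounded_measurable (fun x => r * f x).
Proof. by apply: bounded_measurableM; exact: bounded_measurable_cst. Qed.

Lemma bounded_measurable_indic (E : set T) :
  measurable E -> bounded_measurable (\1_E : T -> R).
Proof.
move=> mE; split; first exact: measurable_indic.
by exists 1 => x; rewrite indicE; case: (_ \in _); rewrite ?normr1 ?normr0.
Qed.

Lemma bounded_measurable_integrable (m : {finite_measure set T -> \bar R}) f :
  bounded_measurable f -> m.-integrable [set: T] (EFin \o f).
Proof.
move=> [mf [K fK]]; apply: measurable_bounded_integrable => //.
  exact: fin_num_fun_lty.
exists K; split; first by rewrite num_real.
by move=> M KM x _ /=; exact: le_trans (fK x) (ltW KM).
Qed.

(** The two Jordan parts are fixed once for all [E] and [f], so that linearity and bounds reduce to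
    those of integrals against finite measures. *)
Lemma charge_integralE (nu : {charge set T -> \bar R}) :
  exists m1 m2 : {finite_measure set T -> \bar R},
    (forall E f, charge_integral nu E f = Rintegral m1 E f - Rintegral m2 E f)
    /\ forall E, measurable E -> fine (nu E) = fine (m1 E) - fine (m2 E).
Proof.
pose h := svalP (cid (svalP (cid (Hahn_decomposition nu)))).
exists (jordan_pos h), (jordan_neg h); split => // E mE.
rewrite (jordan_decomp h mE) /cadd/= cscaleN1 fineB ?fin_num_measure//.
Qed.

Lemma charge_integralD (nu : {charge set T -> \bar R}) f g :
  bounded_measurable f -> bounded_measurable g ->
  charge_integral nu setT (fun x => f x + g x) =
  charge_integral nu setT f + charge_integral nu setT g.
Proof.
have [m1 [m2 [nuE _]]] := charge_integralE nu => bf bg.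
by rewrite !nuE !RintegralD//; [ring|exact: bounded_measurable_integrable..].
Qed.

Lemma charge_integralZ (nu : {charge set T -> \bar R}) r f :
  bounded_measurable f ->
  charge_integral nu setT (fun x => r * f x) = r * charge_integral nu setT f.
Proof.
have [m1 [m2 [nuE _]]] := charge_integralE nu => bf.
by rewrite !nuE !RintegralZl//; [ring|exact: bounded_measurable_integrable..].
Qed.

(** It turns the value on [E] of a charge with a density into a functional of the indicator of
    [E]. *)
Lemma charge_integral_mkcond (nu : {charge set T -> \bar R}) E f :
  charge_integral nu E f = charge_integral nu setT (fun x => f x * \1_E x).
Proof.
have [m1 [m2 [nuE _]]] := charge_integralE nu.
have -> : (fun x => f x * \1_E x) = f \_ E.
  apply/funext => x; rewrite patchE indicE.
  by case: ifP; rewrite (mulr1, mulr0).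
by rewrite !nuE Rintegral_mkcond [X in _ - X]Rintegral_mkcond.
Qed.

Lemma charge_integral_indic (nu : {charge set T -> \bar R}) E :
  measurable E -> charge_integral nu setT \1_E = fine (nu E).
Proof.
move=> mE; have [m1 [m2 [nuE ->//]]] := charge_integralE nu.
by rewrite nuE /Rintegral !integral_indic// !setIT.
Qed.

(** The constant is the total mass of the two Jordan parts. This is the continuity that
    [functional_eq0] asks for. *)
Lemma charge_integral_bound (nu : {charge set T -> \bar R}) :
  exists C, forall f K, bounded_measurable f -> (forall x, `|f x| <= K) ->
    `|charge_integral nu setT f| <= C * K.
Proof.
have [m1 [m2 [nuE _]]] := charge_integralE nu.
have bound (m : {finite_measure set T -> \bar R}) f K :
    bounded_measurable f -> (forall x, `|f x| <= K) ->
    `|Rintegral m setT f| <= fine (m setT) * K.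
  move=> bf fK; have intf := bounded_measurable_integrable m bf.
  apply: le_trans (le_normr_Rintegral _ intf) _ => //.
  rewrite mulrC -Rintegral_cst//; apply: le_Rintegral => //.
  - exact: (integrable_norm (f := f)).
  - by apply: bounded_measurable_integrable; exact: bounded_measurable_cst.
exists (fine (m1 setT) + fine (m2 setT)) => f K bf fK.
by rewrite nuE mulrDl (le_trans (ler_normB _ _))// lerD// bound.
Qed.

(* Subtracting K/2 on {g >= K/2} halves the bound K of a nonnegative g without
   changing D g. *)
Lemma functional_eq0 (D : (T -> R) -> R) :
  (forall f g, bounded_measurable f -> bounded_measurable g ->
     D (fun x => f x + g x) = D f + D g) ->
  (forall r f, bounded_measurable f -> D (fun x => r * f x) = r * D f) ->
  (forall E, measurable E -> D \1_E = 0) ->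
  (exists C, forall f K, bounded_measurable f -> (forall x, `|f x| <= K) ->
     `|D f| <= C * K) ->
  forall f, bounded_measurable f -> D f = 0.
Proof.
move=> DD DZ D1 [C DC].
have D_ge0 n : forall f K, bounded_measurable f ->
    (forall x, 0 <= f x <= K) -> `|D f| <= C * (K / 2 ^+ n).
  elim: n => [|n IHn] f K bf fK.
    rewrite expr0 divr1; apply: DC => // x.
    by case/andP: (fK x) => f0 fK'; rewrite ger0_norm.
  pose E := [set x | K / 2 <= f x].
  have mE : measurable E.
    have -> : E = setT `&` f @^-1` [set` `[K / 2, +oo[].
      by apply/seteqP; split=> x; rewrite /E /= in_itv /= andbT; tauto.
    by apply: bf.1 => //; exact: measurable_itv.
  have b1 := bounded_measurable_indic mE.
  have bE : bounded_measurable (fun x => - (K / 2) * \1_E x).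
    exact: bounded_measurableZ.
  have -> : D f = D (fun x => f x + - (K / 2) * \1_E x).
    by rewrite DD// DZ// D1// mulr0 addr0.
  have -> : K / 2 ^+ n.+1 = K / 2 / 2 ^+ n by rewrite exprS invfM mulrA.
  apply: IHn; first exact: bounded_measurableD.
  move=> x; rewrite indicE; case/andP: (fK x) => f0 fK'.
  case: (boolP (x \in E)) => [|/negP]; rewrite inE /E /= => xE.
    by apply/andP; split; lra.
  by move/negP: xE; rewrite -ltNge => xE; apply/andP; split; lra.
move=> f bf; have [mf [K fK]] := bf.
have bK := bounded_measurable_cst K.
have DK : D (fun=> K) = 0.
  have -> : (fun=> K) = (fun x : T => K * \1_[set: T] x).
    by apply/funext => x; rewrite indicT mulr1.
  by rewrite DZ ?D1 ?mulr0//; exact: bounded_measurable_indic.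
(* [D] kills constants, and [f + K] takes values between 0 and [K + K], where the halving bound
   applies. *)
have -> : D f = D (fun x => f x + K) by rewrite DD// DK addr0.
have le0 n : `|D (fun x => f x + K)| <= C * (K + K) / 2 ^+ n.
  rewrite -mulrA; apply: D_ge0; first exact: bounded_measurableD.
  by move=> x; move: (fK x); rewrite ler_norml => /andP[? ?]; apply/andP; split; lra.
apply/eqP; rewrite -normr_le0.
have cvg0 : (fun n => C * (K + K) / 2 ^+ n) @ \oo --> C * (K + K) * 0.
  apply: cvgMl_tmp; under eq_fun do rewrite -exprVn.
  by apply: cvg_expr; rewrite ger0_norm; lra.
rewrite mulr0 in cvg0.
rewrite -(cvg_lim (@Rhausdorff R) cvg0); apply: limr_ge.
  by apply/cvg_ex; exists 0.
by near=> n; exact: le0.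
Unshelve. all: by end_near.
Qed.

End charge_functional.

(** * Complex measures on the circle *)

Section complexification.
Variables (R : realType) (T : Type) (P : (T -> R) -> Prop).
Variables (I1 I2 : (T -> R) -> R).

(** This is [I1 + i I2] applied to [u + i v]. Keeping the functionals abstract separates the complex
    algebra from integration. *)
Definition complexify (u v : T -> R) : R[i] :=
  (I1 u - I2 v) +i* (I2 u + I1 v).

Hypothesis PZ : forall r u, P u -> P (fun x => r * u x).
Hypothesis I1D : forall u v, P u -> P v -> I1 (fun x => u x + v x) = I1 u + I1 v.
Hypothesis I2D : forall u v, P u -> P v -> I2 (fun x => u x + v x) = I2 u + I2 v.
Hypothesis I1Z : forall r u, P u -> I1 (fun x => r * u x) = r * I1 u.
Hypothesis I2Z : forall r u, P u -> I2 (fun x => r * u x) = r * I2 u.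

Lemma complexifyD u v u' v' : P u -> P v -> P u' -> P v' ->
  complexify (fun x => u x + u' x) (fun x => v x + v' x) =
  complexify u v + complexify u' v'.
Proof.
move=> Pu Pv Pu' Pv'; rewrite /complexify !I1D// !I2D//.
by apply/eqP; rewrite eq_complex /=; apply/andP; split; apply/eqP; ring.
Qed.

(** The arguments on the left are the real and imaginary parts of [(a + i b) (u + i v)]. *)
Lemma complexifyZ a b u v : P u -> P v ->
  complexify (fun x => a * u x + -1 * (b * v x)) (fun x => a * v x + b * u x) =
  (a +i* b) * complexify u v.
Proof.
move=> Pu Pv; rewrite /complexify !(I1D, I2D); do ?[exact: PZ | exact/PZ/PZ].
rewrite !(I1Z, I2Z); do ?[exact: PZ | by []].
by apply/eqP; rewrite eq_complex /=; apply/andP; split; apply/eqP; ring.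
Qed.

(** The hypotheses say, on real test functions, that [H1 + i H2] has density [a + i b] with respect
    to [I1 + i I2]; linearity extends this to complex test functions. *)
Lemma complexify_density (H1 H2 : (T -> R) -> R) (a b : T -> R) :
  (forall u, P u -> P (fun x => u x * a x)) ->
  (forall u, P u -> P (fun x => u x * b x)) ->
  (forall u, P u -> H1 u = I1 (fun x => u x * a x) - I2 (fun x => u x * b x)) ->
  (forall u, P u -> H2 u = I2 (fun x => u x * a x) + I1 (fun x => u x * b x)) ->
  forall u v, P u -> P v ->
  (H1 u - H2 v) +i* (H2 u + H1 v) =
  complexify (fun x => u x * a x + -1 * (v x * b x))
             (fun x => u x * b x + v x * a x).
Proof.
move=> Pa Pb H1E H2E u v Pu Pv; rewrite /complexify !H1E// !H2E//.
rewrite !(I1D, I2D); do ?[exact: Pa | exact: Pb | exact/PZ/Pb].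
rewrite !(I1Z, I2Z); do ?[exact: Pb].
by apply/eqP; rewrite eq_complex /=; apply/andP; split; apply/eqP; ring.
Qed.

End complexification.

(** * Integration of complex functions on the circle *)

Section cmeasure_integral.
Variable R : realType.
Local Notation T := (circle_borel R).
Implicit Types (mu : cmeasure R) (f g : R[i] -> R[i]).

(** Only values on the circle count, so Laurent polynomials qualify despite their pole at 0. *)
Definition bounded_borel f :=
  bounded_measurable (fun z : T => complex.Re (f (val z))) /\
  bounded_measurable (fun z : T => complex.Im (f (val z))).

Lemma complex_ReD (x y : R[i]) : complex.Re (x + y) = complex.Re x + complex.Re y.
Proof. by case: x y => [a b] [a' b']. Qed.

Lemma complex_ImD (x y : R[i]) : complex.Im (x + y) = complex.Im x + complex.Im y.
Proof. by case: x y => [a b] [a' b']. Qed.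

(* The coefficient -1 matches the closure of bounded functions under sums and
   scalings only. *)
Lemma complex_ReM (x y : R[i]) : complex.Re (x * y) =
  complex.Re x * complex.Re y + -1 * (complex.Im x * complex.Im y).
Proof. by case: x y => [a b] [a' b'] /=; ring. Qed.

Lemma complex_ImM (x y : R[i]) : complex.Im (x * y) =
  complex.Re x * complex.Im y + complex.Im x * complex.Re y.
Proof. by case: x y => [a b] [a' b'] /=; ring. Qed.

Lemma bounded_borel_cst k : bounded_borel (fun=> k).
Proof. by split; exact: bounded_measurable_cst. Qed.

Lemma bounded_borelD f g : bounded_borel f -> bounded_borel g ->
  bounded_borel (fun z => f z + g z).
Proof.
move=> [bf bf'] [bg bg']; split.
- under eq_fun do rewrite complex_ReD; exact: bounded_measurableD.
- under eq_fun do rewrite complex_ImD; exact: bounded_measurableD.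
Qed.

Lemma bounded_borelM f g : bounded_borel f -> bounded_borel g ->
  bounded_borel (fun z => f z * g z).
Proof.
move=> [bf bf'] [bg bg']; split.
- under eq_fun do rewrite complex_ReM; apply: bounded_measurableD.
    exact: bounded_measurableM.
  by apply: bounded_measurableZ; exact: bounded_measurableM.
- under eq_fun do rewrite complex_ImM.
  by apply: bounded_measurableD; exact: bounded_measurableM.
Qed.

Lemma circle_open_measurable (V : set T) : circle_open V -> measurable V.
Proof. by move=> oV; exact: sub_sigma_algebra. Qed.

(** The Borel sets of the line are generated by open half-lines, whose preimages under a Lipschitz
    function are open. *)
Lemma circle_lipschitz_measurable (u : R[i] -> R) :
  (forall z w : R[i], (`|u z - u w|)%:C <= `|z - w|) ->
  measurable_fun [set: T] (u \o val).
Proof.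
move=> u_lip; apply: (measurability _ (RGenOInfty.measurableE R)).
move=> _ [_ [a ->] <-]; rewrite setTI; apply: circle_open_measurable.
exists [set z : R[i]^o | a < u z]; last first.
  by apply/seteqP; split => z /=; rewrite in_itv /= andbT.
rewrite openE => z /= az; apply/nbhs_ballP.
(* With Lipschitz constant 1, [u] stays above [a] within distance [u z - a] of [z]. *)
exists (u z - a)%:C; first by rewrite /= ltcR subr_gt0.
move=> w /=; rewrite -ball_normE /= => zw.
have := le_lt_trans (u_lip z w) zw; rewrite ltcR ltr_norml => /andP[_].
by lra.
Qed.

(** Real and imaginary parts are additive and dominated by the modulus, hence 1-Lipschitz, and
    bounded by 1 on the circle. *)
Lemma bounded_borel_id : bounded_borel id.
Proof.
have normE (z : T) : `|val z| = 1 by apply/eqP; exact: (valP z).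
have bd (u : R[i] -> R) : (forall z, (`|u z|)%:C <= `|z|) ->
    (forall z w, u (z - w) = u z - u w) ->
    bounded_measurable (fun z : T => u (val z)).
  move=> u_le uB; split.
    by apply: circle_lipschitz_measurable => z w; rewrite -uB.
  by exists 1 => z; rewrite -(@lecR R) (le_trans (u_le _))// normE.
split; apply: bd => [[a b]|[a b] [a' b']//]; rewrite normc_def lecR -sqrtr_sqr
  ler_wsqrtr//= ?lerDl ?lerDr ?sqr_ge0//.
Qed.

Lemma eq_bounded_borel f g : (forall z, `|z| = 1 -> f z = g z) ->
  bounded_borel f -> bounded_borel g.
Proof.
move=> fg; have fgT (z : T) : f (val z) = g (val z).
  by apply/fg/eqP; exact: (valP z).
by move=> [bf bf']; split; under eq_fun do rewrite -fgT.
Qed.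

Lemma bounded_borel_inv : bounded_borel (@GRing.inv R[i]).
Proof.
have [br bi] := bounded_borel_id.
(* On the unit circle the inverse is the complex conjugate. *)
apply: (@eq_bounded_borel (fun z => complex.Re z -i* complex.Im z)).
  by move=> z z1; rewrite invC_norm z1 expr1n invr1 mul1r; case: z {z1}.
split => //=; under eq_fun do rewrite -mulN1r.
exact: bounded_measurableZ.
Qed.

Lemma bounded_borelX f n : bounded_borel f -> bounded_borel (fun z => f z ^+ n).
Proof.
move=> bf; elim: n => [|n IHn]; first exact: bounded_borel_cst.
under [X in bounded_borel X]eq_fun do rewrite exprS.
exact: bounded_borelM.
Qed.

Lemma eq_cm_integral mu f g : (forall z, `|z| = 1 -> f z = g z) ->
  cm_integral mu setT f = cm_integral mu setT g.
Proof.
move=> fg; have fgT (z : T) : f (val z) = g (val z).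
  by apply/fg/eqP; exact: (valP z).
rewrite /cm_integral.
under [fun z : T => complex.Re (f _)]eq_fun do rewrite fgT.
by under [fun z : T => complex.Im (f _)]eq_fun do rewrite fgT.
Qed.

Let CI mu := complexify (charge_integral (cm_re mu) setT)
  (charge_integral (cm_im mu) setT).

Let cm_integralE mu f : cm_integral mu setT f =
  CI mu (fun z => complex.Re (f (val z))) (fun z => complex.Im (f (val z))).
Proof. by []. Qed.

Lemma cm_integralD mu f g : bounded_borel f -> bounded_borel g ->
  cm_integral mu setT (fun z => f z + g z) =
  cm_integral mu setT f + cm_integral mu setT g.
Proof.
case=> bf bf'; case=> bg bg'; rewrite !cm_integralE.
have CID nu := @charge_integralD R nu.
rewrite -(complexifyD (CID (cm_re mu)) (CID (cm_im mu)) bf bf' bg bg').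
by congr complexify; apply/funext => z; rewrite (complex_ReD, complex_ImD).
Qed.

Lemma cm_integralZ mu k f : bounded_borel f ->
  cm_integral mu setT (fun z => k * f z) = k * cm_integral mu setT f.
Proof.
case: k => a b; case=> bf bf'; rewrite !cm_integralE.
have bZ := @bounded_measurableZ R.
have CID nu := @charge_integralD R nu.
have CIZ nu := @charge_integralZ R nu.
rewrite -(complexifyZ bZ (CID (cm_re mu)) (CID (cm_im mu))
  (CIZ (cm_re mu)) (CIZ (cm_im mu)) a b bf bf').
by congr complexify; apply/funext => z; rewrite (complex_ReM, complex_ImM).
Qed.

Lemma bounded_borel_sum (I : Type) (s : seq I) (F : I -> R[i] -> R[i]) :
  (forall i, bounded_borel (F i)) ->
  bounded_borel (fun z => \sum_(i <- s) F i z).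
Proof.
move=> bF; have b0 := bounded_borel_cst 0.
elim: s => [|i s IHs]; first by under eq_fun do rewrite big_nil.
by under eq_fun do rewrite big_cons; exact: bounded_borelD.
Qed.

Lemma cm_integral_sum mu (I : Type) (s : seq I) (F : I -> R[i] -> R[i]) :
  (forall i, bounded_borel (F i)) ->
  cm_integral mu setT (fun z => \sum_(i <- s) F i z) =
  \sum_(i <- s) cm_integral mu setT (F i).
Proof.
move=> bF; have b0 := bounded_borel_cst 0.
elim: s => [|i s IHs].
  rewrite big_nil -[RHS](mul0r (cm_integral mu setT (fun=> 0))) -cm_integralZ//.
  by apply: eq_cm_integral => z _; rewrite big_nil mul0r.
rewrite big_cons -IHs -cm_integralD//.
  by apply: eq_cm_integral => z _; rewrite big_cons.
exact: bounded_borel_sum.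
Qed.

(** The difference of the two sides is linear and bounded in [h] and vanishes on indicators, so
    [functional_eq0] applies. The combination of two charges is the real part of a complex density
    relation. *)
Lemma charge_integral_density (nu nu1 nu2 : {charge set T -> \bar R})
    (u v : T -> R) :
  bounded_measurable u -> bounded_measurable v ->
  (forall E, measurable E ->
     fine (nu E) = charge_integral nu1 E u - charge_integral nu2 E v) ->
  forall h, bounded_measurable h ->
    charge_integral nu setT h =
    charge_integral nu1 setT (fun x => h x * u x) -
    charge_integral nu2 setT (fun x => h x * v x).
Proof.
move=> bu bv nuE f bf; apply/eqP; rewrite -subr_eq0; apply/eqP.
pose D h := charge_integral nu setT h -
  (charge_integral nu1 setT (fun x => h x * u x) -
   charge_integral nu2 setT (fun x => h x * v x)).
have bM w h : bounded_measurable w -> bounded_measurable h ->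
    bounded_measurable (fun x => h x * w x).
  by move=> bw bh; exact: bounded_measurableM.
apply: (@functional_eq0 _ D) => //.
- move=> g h bg bh; rewrite /D charge_integralD//.
  under [fun x => _ * u x]eq_fun do rewrite mulrDl.
  under [fun x => _ * v x]eq_fun do rewrite mulrDl.
  by rewrite !charge_integralD; [ring|exact: bM..].
- move=> r g bg; rewrite /D charge_integralZ//.
  under [fun x => _ * u x]eq_fun do rewrite -mulrA.
  under [fun x => _ * v x]eq_fun do rewrite -mulrA.
  by rewrite !charge_integralZ; [ring|exact: bM..].
- move=> E mE; rewrite /D charge_integral_indic// nuE//.
  rewrite !(charge_integral_mkcond _ E).
  under [fun x => _ * u x]eq_fun do rewrite mulrC.
  under [fun x => _ * v x]eq_fun do rewrite mulrC.
  by rewrite subrr.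
have [C HC] := charge_integral_bound nu.
have [C1 HC1] := charge_integral_bound nu1.
have [C2 HC2] := charge_integral_bound nu2.
have [_ [K uK]] := bu; have [_ [K' vK]] := bv.
(* [K] and [K'] bound [u] and [v], so [M * K] and [M * K'] bound the two products. *)
exists (C + (C1 * K + C2 * K')) => h M bh hM; rewrite /D.
apply: le_trans (ler_normB _ _) _; rewrite mulrDl lerD ?HC//.
apply: le_trans (ler_normB _ _) _; rewrite mulrDl -!mulrA ![_ * M]mulrC.
by rewrite lerD// (HC1, HC2)//; try exact: bM; move=> x; rewrite normrM ler_pM.
Qed.

Lemma cm_integral_density mu nu (w f : R[i] -> R[i]) :
  has_density nu mu w -> bounded_borel w -> bounded_borel f ->
  cm_integral nu setT f = cm_integral mu setT (fun z => f z * w z).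
Proof.
move=> nuE [bu bv] [bf bf'].
have reE := charge_integral_density bu bv
  (fun E mE => congr1 (@complex.Re R) (nuE E mE)).
(* The imaginary part of the relation is a sum; replacing [v] by [-v] gives it the shape of a
   difference. *)
have bNv := bounded_measurableZ (- 1) bv.
have imE h : bounded_measurable h -> charge_integral (cm_im nu) setT h =
    charge_integral (cm_im mu) setT (fun x => h x * complex.Re (w (val x))) +
    charge_integral (cm_re mu) setT (fun x => h x * complex.Im (w (val x))).
  move=> bh; rewrite (charge_integral_density bu bNv
    (nu1 := cm_im mu) (nu2 := cm_re mu))//.
    under [fun x => _ * (-1 * _)]eq_fun do rewrite mulrCA.
    by rewrite charge_integralZ; [ring|exact: bounded_measurableM].
  move=> E mE; have /(congr1 (@complex.Im R)) /= -> := nuE E mE.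
  rewrite [X in _ - X]charge_integral_mkcond [X in _ + X]charge_integral_mkcond.
  under [fun x => (-1 * _) * _]eq_fun do rewrite -mulrA.
  rewrite charge_integralZ; first by ring.
  by apply: bounded_measurableM => //; exact: bounded_measurable_indic.
have bZ := @bounded_measurableZ R.
have CID m := @charge_integralD R m.
have CIZ m := @charge_integralZ R m.
rewrite [LHS](complexify_density bZ (CID (cm_re mu)) (CID (cm_im mu))
  (CIZ (cm_re mu)) (CIZ (cm_im mu)) _ _ reE imE bf bf').
- rewrite cm_integralE.
  by congr complexify; apply/funext => z; rewrite (complex_ReM, complex_ImM).
- by move=> h bh; exact: bounded_measurableM.
- by move=> h bh; exact: bounded_measurableM.
Qed.

End cmeasure_integral.

(** * Triangular and banded semi-infinite matrices *)

Section semi_infinite_matrices.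
Variable R : realType.
Local Notation C := R[i].

(** Once the terms vanish from index [m] on, the finitely supported sum is an ordinary one; entries
    of products are computed this way. *)
Lemma smulE (I J : Type) (A : I -> nat -> C) (B : nat -> J -> C) m i j :
  (forall k, (m <= k)%N -> A i k * B k j = 0) ->
  smul A B i j = \sum_(k < m) A i k * B k j.
Proof.
move=> AB0; rewrite (@fsbig_ord C 0 _ m (fun k => A i k * B k j)) /smul.
apply: esym; apply: fsbig_widen => // k [_ /= /negP].
by rewrite -leqNgt => /AB0.
Qed.

Lemma eq_smul (I J : Type) (A A' : I -> nat -> C) (B B' : nat -> J -> C) i j :
  (forall k, A i k * B k j = A' i k * B' k j) -> smul A B i j = smul A' B' i j.
Proof. by move=> AB; rewrite /smul; apply: eq_fsbigr => k _. Qed.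

Lemma smul1l (J : Type) (B : nat -> J -> C) : smul (@sid R) B = B.
Proof.
apply/funext => i; apply/funext => j; rewrite (@smulE _ _ _ _ i.+1).
  rewrite (bigD1 ord_max)//= /sid eqxx mul1r big1 ?addr0// => k.
  by rewrite -val_eqE /= eq_sym => /negPf ->; rewrite mul0r.
by move=> k ik; rewrite /sid (ltn_eqF ik) mul0r.
Qed.

Lemma smul1r (I : Type) (A : I -> nat -> C) : smul A (@sid R) = A.
Proof.
apply/funext => i; apply/funext => j; rewrite (@smulE _ _ _ _ j.+1).
  rewrite (bigD1 ord_max)//= /sid eqxx mulr1 big1 ?addr0// => k.
  by rewrite -val_eqE /= => /negPf ->; rewrite mulr0.
by move=> k jk; rewrite /sid (gtn_eqF jk) mulr0.
Qed.

(** * Associativity of semi-infinite products *)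

Definition row_finite (I : Type) (A : I -> nat -> C) :=
  forall i, exists m, forall k, (m <= k)%N -> A i k = 0.

Definition col_finite (J : Type) (B : nat -> J -> C) :=
  forall j, exists m, forall k, (m <= k)%N -> B k j = 0.

Lemma row_finite_uniform (B : smatrix R) m : row_finite B ->
  exists n, forall k l, (k < m)%N -> (n <= l)%N -> B k l = 0.
Proof.
move=> rB; elim: m => [|m [n Bn]]; first by exists 0%N.
have [n' Bn'] := rB m; exists (maxn n n') => k l.
rewrite geq_max ltnS leq_eqVlt => /orP[/eqP -> | km] /andP[nl n'l].
  exact: Bn'.
exact: Bn.
Qed.

(** Row [i] of [A] stops at [m], and the terms [B k l * D l j] with [k < m] stop at [n], so both
    sides are the same finite double sum. *)
Lemma smulA_left (I J : Type) (A : I -> nat -> C) (B : smatrix R)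
    (D : nat -> J -> C) i j m n :
  (forall k, (m <= k)%N -> A i k = 0) ->
  (forall k l, (k < m)%N -> (n <= l)%N -> B k l * D l j = 0) ->
  smul A (smul B D) i j = smul (smul A B) D i j.
Proof.
move=> A0 BD0.
have AB l : smul A B i l = \sum_(k < m) A i k * B k l.
  by apply: smulE => k /A0 ->; rewrite mul0r.
rewrite (@smulE _ _ _ _ m); last by move=> k /A0 ->; rewrite mul0r.
rewrite (@smulE _ _ _ _ n); last first.
  move=> l nl; rewrite AB mulr_suml big1// => k _.
  by rewrite -mulrA BD0 ?mulr0.
under [RHS]eq_bigr do rewrite AB mulr_suml.
rewrite exchange_big; apply: eq_bigr => k _.
rewrite (@smulE _ _ _ _ n) => [|l]; last exact: BD0.
by rewrite mulr_sumr; apply: eq_bigr => l _; rewrite mulrA.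
Qed.

Lemma smul_trmx (I J : Type) (A : I -> nat -> C) (B : nat -> J -> C) i j :
  smul (fun j k => B k j) (fun k i => A i k) j i = smul A B i j.
Proof. by rewrite /smul; apply: eq_fsbigr => k _; rewrite mulrC. Qed.

Lemma smulA_rr (I J : Type) (A : I -> nat -> C) (B : smatrix R)
    (D : nat -> J -> C) : row_finite A -> row_finite B ->
  smul A (smul B D) = smul (smul A B) D.
Proof.
move=> rA rB; apply/funext => i; apply/funext => j.
have [m A0] := rA i; have [n B0] := row_finite_uniform m rB.
by apply: (@smulA_left _ _ _ _ _ _ _ m n) => // k l km nl; rewrite B0// mul0r.
Qed.

Lemma smulA_rc (I J : Type) (A : I -> nat -> C) (B : smatrix R)
    (D : nat -> J -> C) : row_finite A -> col_finite D ->
  smul A (smul B D) = smul (smul A B) D.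
Proof.
move=> rA cD; apply/funext => i; apply/funext => j.
have [m A0] := rA i; have [n D0] := cD j.
by apply: (@smulA_left _ _ _ _ _ _ _ m n) => // k l km nl; rewrite D0// mulr0.
Qed.

(** Transposition exchanges column and row finiteness and reduces this to [smulA_rr]. *)
Lemma smulA_cc (I J : Type) (A : I -> nat -> C) (B : smatrix R)
    (D : nat -> J -> C) : col_finite B -> col_finite D ->
  smul A (smul B D) = smul (smul A B) D.
Proof.
move=> cB cD; have rD : row_finite (fun j l => D l j) by [].
have rB : row_finite (fun l k => B k l) by [].
apply/funext => i; apply/funext => j.
pose At k i := A i k; pose Bt l k := B k l; pose Dt j l := D l j.
transitivity (smul (smul Dt Bt) At j i).
  rewrite -[LHS]smul_trmx; apply: eq_smul => k; congr (_ * _).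
  exact: esym (smul_trmx _ _ _ _).
transitivity (smul Dt (smul Bt At) j i).
  by rewrite (smulA_rr At rD rB).
rewrite -[RHS]smul_trmx; apply: eq_smul => l; congr (_ * _).
exact: smul_trmx.
Qed.

(** Only superdiagonals are limited, so lower triangular matrices have bandwidth 0 and bandwidths
    add under products. *)
Definition banded (b : nat) (A : smatrix R) :=
  forall i k, (i + b < k)%N -> A i k = 0.

Lemma banded_row_finite b A : banded b A -> row_finite A.
Proof. by move=> bA i; exists (i + b).+1 => k; exact: bA. Qed.

Lemma slower_banded A : slower A -> banded 0 A.
Proof. by move=> lA i k; rewrite addn0; exact: lA. Qed.

Lemma slower_row_finite A : slower A -> row_finite A.
Proof. by move/slower_banded/banded_row_finite. Qed.

Lemma supper_col_finite A : supper A -> col_finite A.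
Proof. by move=> uA j; exists j.+1 => k; exact: uA. Qed.

Lemma banded_smul a b A B : banded a A -> banded b B ->
  banded (a + b) (smul A B).
Proof.
move=> bA bB i k ik; rewrite (@smulE _ _ _ _ (i + a).+1).
  by rewrite big1// => l _; rewrite bB ?mulr0//; have := ltn_ord l; lia.
by move=> l il; rewrite bA ?mul0r.
Qed.

(** Only the inner index [i + a] survives: smaller ones fall outside the band of [B], larger ones
    outside that of [A]. *)
Lemma banded_smul_extreme a b A B i : banded a A -> banded b B ->
  smul A B i (i + (a + b))%N = A i (i + a)%N * B (i + a)%N (i + (a + b))%N.
Proof.
move=> bA bB; rewrite (@smulE _ _ _ _ (i + a).+1).
  rewrite (bigD1 ord_max)//= big1 ?addr0// => l; rewrite -val_eqE /= => la.
  by rewrite bB ?mulr0//; have := ltn_ord l; lia.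
by move=> l il; rewrite bA ?mul0r.
Qed.

Lemma slower_smul_diag (A B : smatrix R) i : slower A -> slower B ->
  smul A B i i = A i i * B i i.
Proof.
move=> /slower_banded bA /slower_banded bB.
by have := banded_smul_extreme i bA bB; rewrite !addn0.
Qed.

(** * Inverses of triangular matrices *)

Lemma slower_left_inverse (L : smatrix R) : slower L ->
  (forall i, L i i != 0) ->
  exists X, [/\ slower X, forall i, X i i != 0 & smul X L = @sid R].
Proof.
move=> lL L0.
pose T i : 'M[C]_i.+1 := \matrix_(a, b) L a b.
have Tu i : T i \in unitmx.
  rewrite unitmxE det_trig; last by apply/is_trig_mxP => a b ab; rewrite mxE lL.
  by rewrite unitfE; apply/prodf_neq0 => a _; rewrite mxE.
(* Row [i] of the inverse is the last row of the inverse of the leading section of order [i + 1]. *)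
pose X i k := if (k <= i)%N then invmx (T i) ord_max (inord k) else 0.
have lX : slower X by move=> i k ik; rewrite /X leqNgt ik.
have XL : smul X L = @sid R.
  apply/funext => i; apply/funext => j; rewrite (@smulE _ _ _ _ i.+1); last first.
    by move=> k ik; rewrite lX ?mul0r.
  case: (leqP j i) => ji; last first.
    rewrite big1 /sid ?(ltn_eqF ji)// => k _.
    by rewrite lL ?mulr0//; exact: leq_trans (ltn_ord k) ji.
  have := congr1 (fun A : 'M[C]_i.+1 => A ord_max (inord j)) (mulVmx (Tu i)).
  rewrite /= !mxE -val_eqE /= inordK// /sid => <-.
  apply: eq_bigr => k _; rewrite !mxE inordK// /X -ltnS ltn_ord.
  by congr (invmx _ _ _ * _); apply: val_inj; rewrite /= inordK.
exists X; split=> // i.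
have := congr1 (fun A : smatrix R => A i i) XL.
rewrite slower_smul_diag// /sid eqxx => XL1.
by apply/eqP => Xi; move/eqP: XL1; rewrite Xi mul0r eq_sym oner_eq0.
Qed.

(** The left inverse [X] has a left inverse [Y] in turn, and [Y = Y (X L) = L] makes [X]
    two-sided. *)
Lemma slower_inverse (L : smatrix R) : slower L -> (forall i, L i i != 0) ->
  exists X, [/\ slower X, forall i, X i i != 0, smul L X = @sid R
    & smul X L = @sid R].
Proof.
move=> lL L0; have [X [lX X0 XL]] := slower_left_inverse lL L0.
have [Y [lY _ YX]] := slower_left_inverse lX X0.
exists X; split=> //; rewrite -[RHS]YX; congr smul.
by rewrite -[LHS]smul1l -YX -smulA_rr ?XL ?smul1r//; exact: slower_row_finite.
Qed.

(** The chosen inverse [Y] is not known beforehand to be triangular, but [Y = (X L) Y = X (L Y) = X]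
    by row finiteness of [X] and [L]. *)
Lemma sinv_slower (L : smatrix R) : slower L -> (forall i, L i i != 0) ->
  [/\ slower (sinv L), forall i, sinv L i i != 0, smul L (sinv L) = @sid R
    & smul (sinv L) L = @sid R].
Proof.
move=> lL L0; have [X [lX X0 LX XL]] := slower_inverse lL L0.
suff -> : sinv L = X by [].
rewrite /sinv; case: xgetP => [Y _ /= [LY _]|/(_ X) []//].
rewrite -[LHS]smul1l -XL -smulA_rr ?LY ?smul1r//; exact: slower_row_finite.
Qed.

Lemma sinv_supper (U : smatrix R) : supper U -> (forall i, U i i != 0) ->
  [/\ supper (sinv U), smul U (sinv U) = @sid R & smul (sinv U) U = @sid R].
Proof.
move=> uU U0; have [|//|X [lX _ UX XU]] := @slower_inverse (fun i j => U j i).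
  by move=> i j; exact: uU.
pose Y : smatrix R := fun i j => X j i.
have tr (A B : smatrix R) : smul (fun i j => B j i) (fun i j => A j i) = @sid R ->
    smul A B = @sid R.
  move=> AB; apply/funext => i; apply/funext => j.
  by rewrite -smul_trmx AB /sid eq_sym.
have UY : smul U Y = @sid R by apply: tr.
have YU : smul Y U = @sid R by apply: tr.
have uY : supper Y by move=> i j; exact: lX.
suff -> : sinv U = Y by [].
rewrite /sinv; case: xgetP => [Z _ /= [_ ZU]|/(_ Y) []//].
rewrite -[LHS]smul1r -UY smulA_cc ?ZU ?smul1l//; exact: supper_col_finite.
Qed.

End semi_infinite_matrices.

(** * The connection matrix *)

Section christoffel_connection.
Variable R : realType.
Local Notation C := R[i].
Variables (M W L U Lhat Uhat : smatrix R) (m : nat).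
Hypotheses (M_LU : gauss_borel M L U) (Mhat_LU : gauss_borel (smul W M) Lhat Uhat).
Hypotheses (W_banded : banded m W) (W_extreme : forall i, W i (i + m)%N != 0).

(** Solving [Lhat^-1 Uhat^-1 = W L^-1 U^-1] for [Uhat^-1] and multiplying by [U] on the right
    cancels [U^-1]. *)
Lemma connectionE : connection U Uhat = smul (smul Lhat W) (sinv L).
Proof.
have [lL uU L0 U0 ME] := M_LU; have [lLh uUh Lh0 Uh0 MhE] := Mhat_LU.
have [lX _ LX XL] := sinv_slower lL L0; have [uY UY YU] := sinv_supper uU U0.
have [lXh _ LXh XLh] := sinv_slower lLh Lh0.
have rW := banded_row_finite W_banded.
have rLW := banded_row_finite (banded_smul (slower_banded lLh) W_banded).
have rG := banded_row_finite
  (banded_smul (banded_smul (slower_banded lLh) W_banded) (slower_banded lX)).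
have YhE : sinv Uhat = smul (smul (smul Lhat W) (sinv L)) (sinv U).
  have rLh := slower_row_finite lLh.
  have rX := slower_row_finite lX; have rXh := slower_row_finite lXh.
  by rewrite -[LHS]smul1l -LXh -smulA_rr// -MhE ME -smulA_rr// -smulA_rr.
rewrite /connection YhE -smulA_rc ?YU ?smul1r//; exact: supper_col_finite.
Qed.

Lemma connection_supper : supper (connection U Uhat).
Proof.
have [_ uU _ _ _] := M_LU; have [_ uUh _ Uh0 _] := Mhat_LU.
have [uYh _ _] := sinv_supper uUh Uh0.
move=> i j ji; rewrite /connection (@smulE _ _ _ _ _ j.+1); last first.
  by move=> k /uU ->; rewrite mulr0.
by rewrite big1// => k _; rewrite uYh ?mul0r//; have := ltn_ord k; lia.
Qed.

(** In [connectionE] the outer factors are lower triangular, so the bandwidth is that of [W]. *)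
Lemma connection_banded : banded m (connection U Uhat).
Proof.
have [lL _ L0 _ _] := M_LU; have [lLh _ _ _ _] := Mhat_LU.
have [lX _ _ _] := sinv_slower lL L0; rewrite connectionE.
have := banded_smul (banded_smul (slower_banded lLh) W_banded) (slower_banded lX).
by rewrite addn0.
Qed.

(** The extreme entry is the product of a diagonal entry of [Lhat], an extreme entry of [W] and a
    diagonal entry of [L^-1]. *)
Lemma connection_extreme_neq0 i : connection U Uhat i (i + m)%N != 0.
Proof.
have [lL _ L0 _ _] := M_LU; have [lLh _ Lh0 _ _] := Mhat_LU.
have [lX X0 _ _] := sinv_slower lL L0; rewrite connectionE.
have bLh := slower_banded lLh.
have := banded_smul_extreme i (banded_smul bLh W_banded) (slower_banded lX).
rewrite addn0 => ->; rewrite (banded_smul_extreme i bLh W_banded).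
by rewrite addn0 !mulf_neq0.
Qed.

Lemma connection_Bfun (q : nat) (z : C) :
  smul (connection U Uhat) (@Bfun R q L z) = smul Lhat (smul W (@Zmat R q z)).
Proof.
have [lL _ L0 _ _] := M_LU; have [lLh _ _ _ _] := Mhat_LU.
have [lX _ _ XL] := sinv_slower lL L0.
have rLh := slower_row_finite lLh; have rW := banded_row_finite W_banded.
have rLW := banded_row_finite (banded_smul (slower_banded lLh) W_banded).
have rN := banded_row_finite connection_banded.
have rL := slower_row_finite lL; have rX := slower_row_finite lX.
rewrite /Bfun smulA_rr// connectionE -[smul (smul _ _) L]smulA_rr//.
by rewrite XL smul1r -smulA_rr.
Qed.

(** Here [Uhat] cancels its inverse; column finiteness justifies the regrouping. *)
Lemma Afun_connection (p : nat) (w : C) :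
  smul (@Afun R p Uhat w) (connection U Uhat) = @Afun R p U w.
Proof.
have [_ uU _ _ _] := M_LU; have [_ uUh _ Uh0 _] := Mhat_LU.
have [uYh UYh _] := sinv_supper uUh Uh0.
have cU := supper_col_finite uU; have cUh := supper_col_finite uUh.
have cYh := supper_col_finite uYh; have cN := supper_col_finite connection_supper.
by rewrite /Afun -smulA_cc// /connection [smul Uhat _]smulA_cc// UYh smul1l.
Qed.

(** Entry [k] of the product of [Ahat] and the connection matrix, with the inner sum cut at [n]. The
    cut matters only for [k >= n]; below, the value is that of [A_k]. *)
Definition CDcoef (p : nat) (w : C) (n : nat) (a : 'I_p) (k : nat) : C :=
  \sum_(j < n) Afun Uhat w a j * connection U Uhat j k.

(* Where the rows of W Z vanish, N B = 0, so truncating N B at column n only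
   leaves the m columns following n. *)
Lemma CDkernel_connection (p q n : nat) (x y : C) (a : 'I_p) (b : 'I_q) :
  (forall i, smul W (@Zmat R q y) i b = 0) ->
  CDkernel L U n x y a b =
  - \sum_(i < m) CDcoef x^-1 n a (n + i)%N * Bfun L y (n + i)%N b.
Proof.
move=> WZ0; set N := connection U Uhat.
have NB0 j : smul N (@Bfun R q L y) j b = 0.
  rewrite /N connection_Bfun (@smulE _ _ _ _ _ 0%N) ?big_ord0// => k _.
  by rewrite WZ0 mulr0.
have NBsplit (j : 'I_n) : \sum_(k < n) N j k * Bfun L y k b =
    - \sum_(i < m) N j (n + i)%N * Bfun L y (n + i)%N b.
  apply/eqP; rewrite -addr_eq0; apply/eqP.
  rewrite -[RHS](NB0 j) (@smulE _ _ _ _ _ (n + m)).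
    by rewrite big_split_ord.
  by move=> k nmk; rewrite /N connection_banded ?mul0r//; have := ltn_ord j; lia.
(* As [N] is upper triangular, [A_k] with [k < n] involves only the [Ahat_j] with [j < n]. *)
transitivity (\sum_(j < n) Afun Uhat x^-1 a j * \sum_(k < n) N j k * Bfun L y k b).
  under [RHS]eq_bigr do rewrite mulr_sumr.
  rewrite exchange_big; apply: eq_bigr => k _.
  rewrite -Afun_connection (@smulE _ _ _ _ _ n); last first.
    by move=> j nj; rewrite connection_supper ?mulr0//; have := ltn_ord k; lia.
  by rewrite mulr_suml; apply: eq_bigr => j _; rewrite mulrA.
under eq_bigr do rewrite NBsplit mulrN mulr_sumr.
rewrite sumrN exchange_big; congr (- _); apply: eq_bigr => i _.
by rewrite mulr_suml; apply: eq_bigr => j _; rewrite mulrA.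
Qed.

(** Among the first [n] rows of the connection matrix, only the last reaches column [n - 1 + m]. *)
Lemma CDcoef_last (p : nat) (w : C) (n : nat) (a : 'I_p) : (0 < n)%N ->
  CDcoef w n a (n.-1 + m)%N =
  Afun Uhat w a n.-1 * connection U Uhat n.-1 (n.-1 + m)%N.
Proof.
case: n => // n _; rewrite /CDcoef big_ord_recr/= big1 ?add0r// => j _.
by rewrite connection_banded ?mulr0//=; have := ltn_ord j; lia.
Qed.

End christoffel_connection.

(** The linear algebra of the theorem, for any banded [W] that annihilates the columns of [Z] at the
    zeros. *)
Lemma kappa_formula (R : realType) (p q d : nat) (M W L U Lhat Uhat : smatrix R)
    (zeros : 'I_q -> 'I_(2 * d) -> R[i]) (n : nat) :
  (0 < q)%N -> (0 < d)%N ->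
  gauss_borel M L U -> gauss_borel (smul W M) Lhat Uhat ->
  banded (2 * d * q) W -> (forall i, W i (i + 2 * d * q)%N != 0) ->
  (forall i b l, smul W (@Zmat R q (zeros b l)) i b = 0) ->
  (0 < n)%N -> Bmatrix L zeros n \in unitmx ->
  forall (a : 'I_p) (x : R[i]),
    Afun Uhat x^-1 a n.-1 =
      - 1 / connection U Uhat n.-1 (n.-1 + 2 * d * q)%N
      * (kappa L U zeros n a x *m invmx (Bmatrix L zeros n)
         *m elast (q * (2 * d))) 0 0.
Proof.
move=> q0 d0 M_LU Mhat_LU bW eW WZ0 n0 Bu a x.
have dqE : (2 * d * q = q * (2 * d))%N by rewrite mulnC.
rewrite dqE in bW eW *; set m := (q * (2 * d))%N in bW eW *.
have m0 : (m.-1 < m)%N by rewrite prednK// !muln_gt0 q0 d0.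
pose v : 'rV[R[i]]_m := \row_i CDcoef U Uhat x^-1 n a (n + i)%N.
have kE : kappa L U zeros n a x = - (v *m Bmatrix L zeros n).
  apply/rowP => j; case/mxvec_indexP: j => b l.
  rewrite /kappa mxvecE !mxE (CDkernel_connection M_LU Mhat_LU bW)//.
  by congr (- _); apply: eq_bigr => i _; rewrite !mxE mxvecE mxE.
rewrite kE mulNmx mulmxK// mulNmx !mxE (bigD1 (Ordinal m0))//=.
rewrite big1 ?addr0; last first.
  move=> i; rewrite -val_eqE /= !mxE => im.
  by rewrite (_ : (_ == _) = false) ?mulr0//; apply/eqP; move: im; lia.
rewrite !mxE /= prednK ?(leq_ltn_trans _ m0)// eqxx mulr1.
(* [elast] selects the last entry of [v]; positivity of [n] and [m] lets the predecessor move from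
   one to the other. *)
have -> : (n + m.-1 = n.-1 + m)%N by lia.
rewrite (CDcoef_last M_LU Mhat_LU bW _ _ n0) mulrN.
have N0 := connection_extreme_neq0 M_LU Mhat_LU bW eW n.-1.
by field.
Qed.

(** * Multiplication by the Laurent polynomials *)

Section laurent_multiplication.
Variable R : realType.
Local Notation C := R[i].

(** The exponents run through 0, -1, 1, -2, 2 and so on; [Negz k] stands for [-(k + 1)]. *)
Definition Zexponent (m : nat) : int := if odd m then Negz m./2 else Posz m./2.

Definition Zindex (e : int) : nat :=
  match e with Posz k => k.*2 | Negz k => k.*2.+1 end.

Lemma ZblockE (z : C) m : Zblock z m = z ^ Zexponent m.
Proof. by rewrite /Zblock /Zexponent; case: odd. Qed.

Lemma Zblock_Zindex (z : C) e : Zblock z (Zindex e) = z ^ e.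
Proof.
rewrite ZblockE; congr (_ ^ _); case: e => k; rewrite /Zexponent /=.
  by rewrite odd_double doubleK.
by rewrite odd_double /= uphalf_double.
Qed.

(** One step of the exponent away from 0 costs two blocks, and exponents move by at most [d]. *)
Lemma Zindex_shift m d t : (t <= 2 * d)%N ->
  (Zindex (Zexponent m + t%:Z - d%:Z) <= m + 2 * d)%N.
Proof.
move=> td; have mE := odd_double_half m; rewrite /Zexponent.
case: (odd m) mE => /= mE; case E : (_ - _) => [k|k] /=; rewrite -muln2 in mE *;
  lia.
Qed.

(** The bound is reached only by moving outward by [d]: downward from negative exponents (odd [m]),
    upward from the others. *)
Lemma Zindex_shift_max m d t : (0 < d)%N -> (t <= 2 * d)%N ->
  (m + 2 * d == Zindex (Zexponent m + t%:Z - d%:Z))%N =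
  (t == if odd m then 0%N else 2 * d)%N.
Proof.
move=> d0 td; have mE := odd_double_half m; rewrite /Zexponent.
case: (odd m) mE => /= mE; case E : (_ - _) => [k|k] /=; rewrite -muln2 in mE *;
  apply/eqP/eqP; lia.
Qed.

Variables (d q : nat) (q_gt0 : (0 < q)%N).
Variables (c : 'I_q -> C) (zeros : 'I_q -> 'I_(2 * d) -> C).

Definition zeros_poly (b : 'I_q) : {poly C} :=
  \prod_(l < 2 * d) ('X - (zeros b l)%:P).

Lemma size_zeros_poly b : size (zeros_poly b) = (2 * d).+1.
Proof. by rewrite /zeros_poly size_prod_XsubC /index_enum -enumT size_enum_ord. Qed.

Lemma Zblock_laurentW b z m : z != 0 ->
  Zblock z m * laurentW c zeros b z =
  \sum_(t < (2 * d).+1) c b * (zeros_poly b)`_t *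
    Zblock z (Zindex (Zexponent m + t%:Z - d%:Z)).
Proof.
move=> z0; rewrite /laurentW.
have -> : \prod_(l < 2 * d) (z - zeros b l) = (zeros_poly b).[z].
  by rewrite horner_prod; apply: eq_bigr => l _; rewrite hornerXsubC.
rewrite horner_coef size_zeros_poly !mulr_sumr; apply: eq_bigr => t _.
rewrite Zblock_Zindex !expfzDr// ZblockE -exprnN.
by rewrite -exprnP; ring.
Qed.

Definition row_class (i : nat) : 'I_q := Ordinal (ltn_pmod i q_gt0).

(** The row of [Z] with the residue of [i] modulo [q] whose power of [z] is that of row [i] times
    [z^(t - d)]. *)
Definition shifted_row (i t : nat) : nat :=
  (Zindex (Zexponent (i %/ q) + t%:Z - d%:Z) * q + i %% q)%N.

Lemma shifted_row_mod i t : (shifted_row i t %% q = i %% q)%N.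
Proof. by rewrite /shifted_row modnMDl modn_mod. Qed.

Lemma shifted_row_div i t :
  (shifted_row i t %/ q = Zindex (Zexponent (i %/ q) + t%:Z - d%:Z))%N.
Proof. by rewrite /shifted_row divnMDl// (divn_small (ltn_pmod i q_gt0)) addn0. Qed.

(* W_[q] Z_[q] = laurent_mx Z_[q]. *)
Definition laurent_mx : smatrix R := fun i k =>
  \sum_(t < (2 * d).+1) c (row_class i) * (zeros_poly (row_class i))`_t *
    (k == shifted_row i t)%:R.

Lemma smul_laurent_mx (J : Type) (F : nat -> J -> C) i j :
  smul laurent_mx F i j =
  \sum_(t < (2 * d).+1) c (row_class i) * (zeros_poly (row_class i))`_t *
    F (shifted_row i t) j.
Proof.
(* A strict upper bound for the columns met by row [i]. *)
pose m := (\max_(t < (2 * d).+1) shifted_row i t).+1.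
have tm (t : 'I_(2 * d).+1) : (shifted_row i t < m)%N.
  by rewrite ltnS (leq_bigmax t).
rewrite (@smulE _ _ _ _ _ m) => [|k mk]; last first.
  rewrite /laurent_mx big1 ?mul0r// => t _.
  by rewrite gtn_eqF ?mulr0//; exact: leq_trans mk.
under eq_bigr do rewrite mulr_suml.
rewrite exchange_big; apply: eq_bigr => t _.
rewrite (bigD1 (Ordinal (tm t)))//= eqxx mulr1 big1 ?addr0// => k.
by rewrite -val_eqE /= => /negPf ->; rewrite mulr0 mul0r.
Qed.

Lemma laurent_mx_banded : banded (2 * d * q) laurent_mx.
Proof.
move=> i k ik; rewrite /laurent_mx big1// => t _.
have td : (t <= 2 * d)%N by rewrite -ltnS.
rewrite gtn_eqF ?mulr0//; apply: leq_ltn_trans ik.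
rewrite /shifted_row {3}(divn_eq i q) addnAC leq_add2r -mulnDl leq_mul2r.
by rewrite Zindex_shift ?orbT.
Qed.

(** A single [t] contributes: it gives [c b] times the leading coefficient 1 for an even block, or
    times the constant coefficient, a product of negated zeros, for an odd one. *)
Lemma laurent_mx_extreme_neq0 i : (0 < d)%N -> (forall b, c b != 0) ->
  (forall b l, zeros b l != 0) -> laurent_mx i (i + 2 * d * q)%N != 0.
Proof.
move=> d0 c0 z0; rewrite /laurent_mx.
set b := row_class i; pose m := (i %/ q)%N.
have t0P : ((if odd m then 0 else 2 * d) < (2 * d).+1)%N by case: ifP.
have iE (t : 'I_(2 * d).+1) : (i + 2 * d * q == shifted_row i t)%N =
    (t == Ordinal t0P).
  rewrite -val_eqE /= -Zindex_shift_max//; last by rewrite -ltnS.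
  rewrite /shifted_row {1}(divn_eq i q) addnAC eqn_add2r -mulnDl eqn_mul2r.
  by rewrite gtn_eqF.
rewrite (bigD1 (Ordinal t0P))// iE eqxx mulr1 big1 => [|t tt0]; last first.
  by rewrite iE (negPf tt0) mulr0.
rewrite /= addr0 mulf_neq0//; case: (odd m).
  rewrite -horner_coef0 horner_prod; apply/prodf_neq0 => l _.
  by rewrite hornerXsubC sub0r oppr_eq0.
have := monic_prod_XsubC (index_enum 'I_(2 * d)) xpredT (zeros b).
rewrite -/(zeros_poly b) monicE lead_coefE size_zeros_poly /= => /eqP ->.
exact: oner_neq0.
Qed.

Lemma laurent_mx_Zmat z i b : z != 0 ->
  smul laurent_mx (@Zmat R q z) i b = Zmat z i b * laurentW c zeros b z.
Proof.
move=> z0; rewrite smul_laurent_mx /Zmat.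
under eq_bigr do rewrite shifted_row_mod shifted_row_div.
case: eqP => ib; last by rewrite mul0r big1// => t _; rewrite mulr0.
have -> : row_class i = b by exact: val_inj.
by rewrite Zblock_laurentW.
Qed.

Lemma laurentW_zero b l : laurentW c zeros b (zeros b l) = 0.
Proof. by rewrite /laurentW (bigD1 l)//= subrr mul0r mulr0. Qed.

(** * Laurent monomials as integrands and the perturbed moment matrix *)

Lemma bounded_borel_Zblock m : bounded_borel (fun z : C => Zblock z m).
Proof.
rewrite /Zblock; case: odd; last exact/bounded_borelX/bounded_borel_id.
under [X in bounded_borel X]eq_fun do rewrite -exprVn.
exact/bounded_borelX/bounded_borel_inv.
Qed.

Lemma bounded_borel_ZblockV m : bounded_borel (fun z : C => Zblock z^-1 m).
Proof.
rewrite /Zblock; case: odd; last exact/bounded_borelX/bounded_borel_inv.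
under [X in bounded_borel X]eq_fun do rewrite exprVn invrK.
exact/bounded_borelX/bounded_borel_id.
Qed.

Lemma circle_neq0 (z : C) : `|z| = 1 -> z != 0.
Proof. by move=> z1; rewrite -normr_eq0 z1 oner_neq0. Qed.

Lemma bounded_borel_laurentW b : bounded_borel (laurentW c zeros b).
Proof.
apply: (@eq_bounded_borel _ (fun z => \sum_(t < (2 * d).+1)
  c b * (zeros_poly b)`_t * Zblock z (Zindex (Zexponent 0 + t%:Z - d%:Z)))).
  by move=> z /circle_neq0 z0; rewrite -Zblock_laurentW//= mul1r.
apply: bounded_borel_sum => t; apply: bounded_borelM.
  exact: bounded_borel_cst.
exact: bounded_borel_Zblock.
Qed.

(** Each row of [Z] has one possibly nonzero column, so a single term of the double sum remains. *)
Lemma momentE (p : nat) (mu : 'I_q -> 'I_p -> cmeasure R) i j (b : 'I_q) (a : 'I_p) :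
  (i %% q = b)%N -> (j %% p = a)%N ->
  moment mu i j = cm_integral (mu b a) setT
    (fun z => Zblock z (i %/ q)%N * Zblock z^-1 (j %/ p)%N).
Proof.
move=> ib ja; rewrite /moment.
have int0 nu : cm_integral nu setT (fun=> 0) = 0 :> C.
  rewrite -[RHS](mul0r (cm_integral nu setT (fun=> 0))) -cm_integralZ.
    by congr cm_integral; apply/funext => z; rewrite mul0r.
  exact: bounded_borel_cst.
rewrite (bigD1 b)//= [X in _ + X]big1 ?addr0 => [|b' b'b]; last first.
  rewrite big1// => a' _; rewrite -[RHS](int0 (mu b' a')).
  congr cm_integral; apply/funext => z; rewrite /Zmat ib.
  by rewrite val_eqE eq_sym (negPf b'b) mul0r.
rewrite (bigD1 a)//= big1 ?addr0 => [|a' a'a]; last first.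
  rewrite -[RHS](int0 (mu b a')).
  congr cm_integral; apply/funext => z; rewrite /Zmat ja.
  by rewrite [X in _ * X]ifN ?mulr0// eq_sym.
by congr cm_integral; apply/funext => z; rewrite /Zmat ib ja !eqxx.
Qed.

(** The change of density puts [laurentW] into the integrand, where it expands into the monomials
    listed by the row of [laurent_mx]. *)
Lemma smul_laurent_mx_moment (p : nat) (mu muhat : 'I_q -> 'I_p -> cmeasure R) :
  (0 < p)%N ->
  (forall b a, has_density (muhat b a) (mu b a) (laurentW c zeros b)) ->
  smul laurent_mx (moment mu) = moment muhat.
Proof.
move=> p0 muhatE; apply/funext => i; apply/funext => j.
pose a : 'I_p := Ordinal (ltn_pmod j p0); set b := row_class i.
have bF m m' : bounded_borel (fun z : C => Zblock z m * Zblock z^-1 m').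
  exact: bounded_borelM (bounded_borel_Zblock m) (bounded_borel_ZblockV m').
rewrite (@momentE _ muhat i j b a)//.
rewrite (cm_integral_density (muhatE b a) (bounded_borel_laurentW b) (bF _ _)).
rewrite smul_laurent_mx.
transitivity (cm_integral (mu b a) setT (fun z => \sum_(t < (2 * d).+1)
    c b * (zeros_poly b)`_t *
    (Zblock z (shifted_row i t %/ q)%N * Zblock z^-1 (j %/ p)%N))).
  rewrite cm_integral_sum => [|t]; last first.
    exact: bounded_borelM (bounded_borel_cst _) (bF _ _).
  apply: eq_bigr => t _; rewrite cm_integralZ//.
  by rewrite (@momentE _ mu (shifted_row i t) j b a)// shifted_row_mod.
apply: eq_cm_integral => z /circle_neq0 z0.
rewrite mulrAC Zblock_laurentW// mulr_suml; apply: eq_bigr => t _.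
by rewrite shifted_row_div mulrA.
Qed.

End laurent_multiplication.

Theorem theorem3p6 (R : realType) (p q d : nat)
    (p_gt0 : (0 < p)%N) (q_gt0 : (0 < q)%N) (d_gt0 : (0 < d)%N)
    (mu muhat : 'I_q -> 'I_p -> cmeasure R)
    (mu_inf : forall b a, infinite_set (cm_support (mu b a)))
    (c : 'I_q -> R[i]) (zeros : 'I_q -> 'I_(2 * d) -> R[i])
    (c_neq0 : forall b, c b != 0)
    (zeros_neq0 : forall b l, zeros b l != 0)
    (zeros_inj : injective (fun bl : 'I_q * 'I_(2 * d) => zeros bl.1 bl.2))
    (muhatE : forall b a, has_density (muhat b a) (mu b a) (laurentW c zeros b))
    (L U Lhat Uhat : smatrix R)
    (M_LU : gauss_borel (moment mu) L U)
    (Mhat_LU : gauss_borel (moment muhat) Lhat Uhat)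
    (n : nat) (n_gt0 : (0 < n)%N)
    (B_unit : Bmatrix L zeros n \in unitmx) :
  forall (a : 'I_p) (x : R[i]), x != 0 ->
    Afun Uhat x^-1 a n.-1 =
      - 1 / connection U Uhat n.-1 (n.-1 + 2 * d * q)%N
      * (kappa L U zeros n a x *m invmx (Bmatrix L zeros n)
         *m elast (q * (2 * d))) 0 0.
Proof.
move=> a x _.
(* The measures enter only through this identity of moment matrices. *)
have WM := smul_laurent_mx_moment q_gt0 p_gt0 muhatE; rewrite -WM in Mhat_LU.
apply: (kappa_formula q_gt0 d_gt0 M_LU Mhat_LU) => //.
- exact: laurent_mx_banded.
- by move=> i; exact: laurent_mx_extreme_neq0.
- by move=> i b l; rewrite laurent_mx_Zmat// laurentW_zero mulr0.
Qed.
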